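(* Let $(J,\mathcal{B})$ be a set-algebra and let $\varphi:\mathcal{B}\to\mathbb{R}$ be a bounded submodular setfunction. Then $\varphi$ has bounded variation.
   Context: A set-algebra $(J,\mathcal{B})$ is a family $\mathcal{B}$ of subsets of $J$ containing $\emptyset$ and $J$ and closed under complements and finite unions. A setfunction $\varphi:\mathcal{B}\to\mathbb{R}$ is submodular if $\varphi(X\cup Y)+\varphi(X\cap Y)\le\varphi(X)+\varphi(Y)$ for all $X,Y\in\mathcal{B}$. It has bounded variation if there is $K\in\mathbb{R}$ such that $\sum_{i=1}^n|\varphi(X_i)-\varphi(X_{i-1})|\le K$ for every chain $\emptyset=X_0\subseteq X_1\subseteq\dots\subseteq X_n=J$ of sets $X_i\in\mathcal{B}$. *)

(* Defs.v *)
From HB Require Import structures.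
From mathcomp Require Import all_boot all_order all_algebra.
From mathcomp Require Import boolp classical_sets reals topology normedtype.
From mathcomp Require Import measure.

Set Implicit Arguments.
Unset Strict Implicit.
Unset Printing Implicit Defensive.

Import Order.TTheory GRing.Theory Num.Theory.
Import numFieldNormedType.Exports.

Local Open Scope classical_set_scope.
Local Open Scope ring_scope.

(* The library's algebraOfSetsType requires a pointed carrier, which would
   exclude an empty J; hence an unbundled predicate on an arbitrary type. *)
Definition set_algebra (J : Type) (B : set (set J)) : Prop :=
  [/\ B set0, B setT, setC_closed B & setU_closed B].

(* In the definitions below a setfunction on B is a total function on set J of
   which only the values on B are ever used. *)
Definition submodular_on (R : realType) (J : Type) (B : set (set J))
    (phi : set J -> R) : Prop :=
  forall X Y, B X -> B Y -> phi (X `|` Y) + phi (X `&` Y) <= phi X + phi Y.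

(* Only X 0, ..., X n matter. *)
Definition full_chain (J : Type) (B : set (set J)) (n : nat)
    (X : nat -> set J) : Prop :=
  [/\ X 0%N = set0, X n = setT,
      forall i, (i <= n)%N -> B (X i) &
      forall i, (i < n)%N -> X i `<=` X i.+1].

Definition bounded_variation_on (R : realType) (J : Type) (B : set (set J))
    (phi : set J -> R) : Prop :=
  exists K : R, forall (n : nat) (X : nat -> set J), full_chain B n X ->
    \sum_(0 <= i < n) `|phi (X i.+1) - phi (X i)| <= K.

(* Main.v *)
(** A submodular function has diminishing returns, so every step of a chain
    [X 0, X 1, ...] raises it by no more than attaching the difference
    [X i.+1 `\` X i] of that step to a smaller set.  Attaching successively to
    the empty set the differences of the increasing steps only, one sees that
    the positive variation along the chain is at most [phi Y - phi set0], where
    [Y] is the union of these differences.  The total variation is twice the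
    positive variation minus the telescoping sum [phi (X n) - phi (X 0)]. *)
Require Import Defs.
From mathcomp Require Import all_boot all_order all_algebra.
From mathcomp Require Import boolp classical_sets reals topology normedtype.
From mathcomp Require Import measure ring lra.

Set Implicit Arguments.
Unset Strict Implicit.
Unset Printing Implicit Defensive.

Import Order.TTheory GRing.Theory Num.Theory.
Import numFieldNormedType.Exports.

Local Open Scope classical_set_scope.
Local Open Scope ring_scope.

Lemma sumr_norm_posE (R : realDomainType) (I : Type) (r : seq I) (F : I -> R) :
  \sum_(i <- r) `|F i| =
    2 * (\sum_(i <- r | 0 < F i) F i) - \sum_(i <- r) F i.
Proof.
rewrite [in RHS]big_mkcond/= mulr_sumr -sumrB; apply: eq_bigr => i _.
have [Fi_gt0|Fi_le0] := ltP 0 (F i); first by rewrite gtr0_norm//; ring.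
by rewrite ler0_norm//; ring.
Qed.

Lemma set_algebra_setring (J : Type) (B : set (set J)) :
  set_algebra B -> setring B.
Proof.
move=> [B0 _ BC BU]; split=> // X Y BX BY.
by rewrite setDE -[X]setCK -setCU; apply: (BC); apply: BU => //; exact: BC.
Qed.

Lemma submodular_diminishing_returns (R : realType) (J : Type)
    (B : set (set J)) (phi : set J -> R) (X Y Z : set J) :
  submodular_on B phi -> B X -> B (Y `|` Z) -> Y `<=` X -> X `&` Z `<=` Y ->
  phi (X `|` Z) - phi X <= phi (Y `|` Z) - phi Y.
Proof.
move=> submod BX BYZ YX XZY; have := submod _ _ BX BYZ.
rewrite setUA (setUidl YX) setIUr (setIidr YX) (setUidl XZY).
lra.
Qed.

Definition bigsetU_increments (J : Type) (X : nat -> set J) (P : pred nat)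
    (n : nat) : set J :=
  \big[setU/set0]_(0 <= i < n | P i) (X i.+1 `\` X i).

Lemma bigsetU_increments0 (J : Type) (X : nat -> set J) (P : pred nat) :
  bigsetU_increments X P 0 = set0.
Proof. exact: big_geq. Qed.

Lemma bigsetU_incrementsS (J : Type) (X : nat -> set J) (P : pred nat)
    (n : nat) :
  bigsetU_increments X P n.+1 =
    if P n then bigsetU_increments X P n `|` (X n.+1 `\` X n)
    else bigsetU_increments X P n.
Proof.
rewrite /bigsetU_increments big_mkcond big_nat_recr//= -big_mkcond.
by case: (P n); rewrite ?setU0.
Qed.

Section chain.
Variables (J : Type) (B : set (set J)) (n : nat) (X : nat -> set J).
Hypothesis ringB : setring B.
Hypothesis BX : forall i, (i <= n)%N -> B (X i).
Hypothesis ndX : forall i, (i < n)%N -> X i `<=` X i.+1.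

Lemma setring_bigsetU_increments (P : pred nat) (m : nat) :
  (m <= n)%N -> B (bigsetU_increments X P m).
Proof.
have [B0 BU BD] := ringB.
elim: m => [|m IHm] m_le_n; first by rewrite bigsetU_increments0.
rewrite bigsetU_incrementsS; case: ifP => _; last exact/IHm/ltnW.
by apply: BU; [exact/IHm/ltnW | apply: BD; apply: BX => //; exact: ltnW].
Qed.

Lemma bigsetU_increments_sub (P : pred nat) (m : nat) :
  (m <= n)%N -> bigsetU_increments X P m `<=` X m.
Proof.
elim: m => [|m IHm] m_lt_n; first by rewrite bigsetU_increments0.
have UXS := subset_trans (IHm (ltnW m_lt_n)) (ndX m_lt_n).
by rewrite bigsetU_incrementsS; case: ifP => // _; rewrite subUset.
Qed.

Variables (R : realType) (phi : set J -> R).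
Hypothesis submod : submodular_on B phi.

Lemma submodular_sum_increments_le (P : pred nat) :
  \sum_(0 <= i < n | P i) (phi (X i.+1) - phi (X i))
    <= phi (bigsetU_increments X P n) - phi set0.
Proof.
pose U := bigsetU_increments X P.
have -> : phi (U n) - phi set0 = \sum_(0 <= i < n) (phi (U i.+1) - phi (U i)).
  by rewrite (telescope_sumr (phi \o U))//= /U bigsetU_increments0.
rewrite big_mkcond; apply: ler_sum_nat => i /andP[_ i_lt_n].
have := setring_bigsetU_increments P i_lt_n.
rewrite /U bigsetU_incrementsS; case: ifP => [_ BUS|_ _]; last by rewrite subrr.
rewrite -[in leLHS](setDUK (ndX i_lt_n)).
apply: (submodular_diminishing_returns submod) => //.
- exact/BX/ltnW.
- exact/bigsetU_increments_sub/ltnW.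
- by rewrite setDIK.
Qed.

Lemma submodular_chain_variation_le :
  exists2 Y, B Y &
    \sum_(0 <= i < n) `|phi (X i.+1) - phi (X i)|
      <= 2 * (phi Y - phi set0) - (phi (X n) - phi (X 0%N)).
Proof.
pose P i := 0 < phi (X i.+1) - phi (X i).
exists (bigsetU_increments X P n); first exact: setring_bigsetU_increments.
rewrite sumr_norm_posE (telescope_sumr (phi \o X))//= lerD2r ler_pM2l//.
exact: submodular_sum_increments_le.
Qed.

End chain.

Theorem theorem2p6 (R : realType) (J : Type) (B : set (set J))
    (phi : set J -> R) (algB : set_algebra B)
    (bnd : [bounded phi X | X in B]) (submod : submodular_on B phi) :
  bounded_variation_on B phi.
Proof.
have [M _ phi_ltM] := ex_strict_bound_gt0 bnd.
have [B0 BT _ _] := algB.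
have ringB := set_algebra_setring algB.
exists (6 * M) => n X [X0 XT BX ndX].
have [Y BY] := submodular_chain_variation_le ringB BX ndX submod.
rewrite X0 XT => /le_trans; apply.
have /ltr_normlP[] := phi_ltM Y BY.
have /ltr_normlP[] := phi_ltM set0 B0.
have /ltr_normlP[] := phi_ltM setT BT.
lra.
Qed.
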